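(* Let $M$ be a positroid on $[n]$ and let $S_1, S_2, \dots, S_t$ be the ground sets of the connected components of $M$. Then $\{S_1,\dots,S_t\}$ is a non-crossing partition of $[n]$. Conversely, if $S_1, S_2, \dots, S_t$ form a non-crossing partition of $[n]$ and $M_1, M_2, \dots, M_t$ are connected positroids on $S_1, S_2, \dots, S_t$ respectively (each $S_i$ carrying the total order inherited from $1<2<\dots<n$), then $M_1 \oplus \dots \oplus M_t$ is a positroid on $[n]$.
   Context: A matroid $M$ on a finite totally ordered set $E=\{e_1<\dots<e_n\}$ is a positroid if there is a real $d\times n$ matrix $A$ of rank $d$, all of whose maximal ($d\times d$) minors are nonnegative, such that the bases of $M$ are exactly the sets $\{e_i : i \in B\}$ for which the columns of $A$ indexed by $B$ form a basis of $\mathbb{R}^d$. A positroid on $[n]$ uses the order $1<2<\dots<n$. The direct sum $M\oplus N$ of matroids on disjoint ground sets $E,F$ is the matroid on $E\sqcup F$ whose bases are the unions of a basis of $M$ and a basis of $N$. A matroid is connected if it is not the direct sum of two matroids on nonempty ground sets; every matroid decomposes uniquely as a direct sum of connected matroids (its connected components). A partition $\{S_1,\dots,S_t\}$ of $[n]$ into nonempty blocks is non-crossing if there are no $a,b,c,d$ in cyclic order around $1,2,\dots,n$ with $a,c\in S_i$ and $b,d\in S_j$ for some $i\neq j$. *)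

(* Defs.v *)
From HB Require Import structures.
From mathcomp Require Import all_boot all_order all_algebra.
From mathcomp Require Import reals.

Set Implicit Arguments.
Unset Strict Implicit.
Unset Printing Implicit Defensive.

Local Open Scope ring_scope.

Section Matroids.
Variable T : finType.

(* Basis axioms, as a boolean, so that two matroids with the same ground set
   and the same bases are equal. *)
Definition matroid_axiom (E : {set T}) (Bs : {set {set T}}) : bool :=
  [&& Bs != set0,
      [forall B in Bs, B \subset E] &
      [forall B1 in Bs, forall B2 in Bs, forall x in B1 :\: B2,
         exists y in B2 :\: B1, (y |: (B1 :\ x)) \in Bs]].

(* Matroids whose ground set is a subset of T (not necessarily all of T). *)
Record matroid := Matroid {
  ground : {set T};
  bases : {set {set T}};
  matroidP : matroid_axiom ground bases
}.

Definition disjoint_grounds (I : finType) (M : I -> matroid) : bool :=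
  [forall i, forall j, (i != j) ==> [disjoint ground (M i) & ground (M j)]].

Definition sum_ground (I : finType) (M : I -> matroid) : {set T} :=
  \bigcup_i ground (M i).

Definition sum_bases (I : finType) (M : I -> matroid) : {set {set T}} :=
  [set \bigcup_i f i | f : {ffun I -> {set T}}
                         in family (fun i => mem (bases (M i)))].

Lemma direct_sum_subproof (I : finType) (M : I -> matroid) :
  disjoint_grounds M -> matroid_axiom (sum_ground M) (sum_bases M).
Proof.
move=> dis.
have bases_sub i B : B \in bases (M i) -> B \subset ground (M i).
  by case/and3P: (matroidP (M i)) => _ /forall_inP sub _; apply: sub.
apply/and3P; split.
- have ne i : exists B, B \in bases (M i).
    by case/and3P: (matroidP (M i)) => /set0Pn.
  apply/set0Pn; exists (\bigcup_i [ffun i => xchoose (ne i)] i).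
  apply/imsetP; exists [ffun i => xchoose (ne i)] => //.
  by apply/familyP => i; rewrite ffunE; exact: xchooseP.
- apply/forall_inP => _ /imsetP[f /familyP fP ->].
  apply/bigcupsP => i _; apply: subset_trans (bases_sub i _ (fP i)) _.
  exact: (bigcup_sup i).
apply/forall_inP => _ /imsetP[f /familyP fP ->].
apply/forall_inP => _ /imsetP[g /familyP gP ->].
apply/forall_inP => x; rewrite inE => /andP[xNg /bigcupP[i _ xfi]].
have only k z j : z \in ground (M k) -> z \in f j -> j = k.
  move=> zk zj; apply/eqP; apply: contraT => jk.
  move/forallP: dis => /(_ j)/forallP/(_ k); rewrite jk /=.
  move/pred0P => /(_ z) /=.
  by rewrite zk (subsetP (bases_sub j _ (fP j)) _ zj).
have xi : x \in ground (M i) := subsetP (bases_sub i _ (fP i)) _ xfi.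
case/and3P: (matroidP (M i)) => _ _ /forall_inP/(_ _ (fP i)).
move=> /forall_inP/(_ _ (gP i))/forall_inP/(_ x).
have xgi : x \notin g i.
  by apply: contra xNg => xgi; apply/bigcupP; exists i.
rewrite inE xgi xfi => /(_ isT)/exists_inP[y].
rewrite inE => /andP[yNf ygi] yB.
have yi : y \in ground (M i) := subsetP (bases_sub i _ (gP i)) _ ygi.
apply/exists_inP; exists y.
  rewrite inE; apply/andP; split; last by apply/bigcupP; exists i.
  by apply/bigcupP => -[j _ yfj]; move: (yfj) yNf; rewrite (only i y j) // => ->.
apply/imsetP; exists [ffun j => if j == i then y |: (f i :\ x) else f j].
  by apply/familyP => j; rewrite ffunE; case: eqP => [->|_].
apply/setP => z; apply/setU1P/bigcupP.
- case=> [->|/setD1P[zx /bigcupP[j _ zfj]]].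
    by exists i; rewrite // ffunE eqxx setU11.
  exists j; rewrite // ffunE; case: eqP => [ji|_] //.
  by rewrite in_setU1 in_setD1 zx -ji zfj orbT.
- case=> j _; rewrite ffunE; case: eqP => [_|ji].
    case/setU1P => [->|/setD1P[zx zfi]]; first by left.
    by right; rewrite in_setD1 zx; apply/bigcupP; exists i.
  move=> zfj; right; rewrite in_setD1; apply/andP; split; last first.
    by apply/bigcupP; exists j.
  by apply/eqP => zx; apply: ji; apply: (only i x) => //; rewrite -zx.
Qed.

Definition direct_sum (I : finType) (M : I -> matroid)
    (dis : disjoint_grounds M) : matroid :=
  Matroid (direct_sum_subproof dis).

(* The two summands are indexed by bool. *)
Definition connected (M : matroid) : Prop :=
  ~ exists (N : bool -> matroid) (dis : disjoint_grounds N),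
      (forall b, ground (N b) != set0) /\ M = direct_sum dis.

(* N enumerates the connected components of M.  The empty matroid, neutral for
   direct sums and connected by the definition above, is not a component. *)
Definition connected_components (M : matroid) (t : nat)
    (N : 'I_t -> matroid) : Prop :=
  [/\ forall i, ground (N i) != set0,
      forall i, connected (N i) &
      exists dis : disjoint_grounds N, M = direct_sum dis].

End Matroids.

Section Positroids.
Variables (R : realType) (n : nat).
Local Open Scope nat_scope.

Definition increasing (m p : nat) (f : 'I_m -> 'I_p) : Prop :=
  forall i j : 'I_m, i < j -> f i < f j.

(* The map e lists the ground set E, a subset of {0, ..., n-1} with the
   inherited order, increasingly: E = {e 0 < ... < e (m-1)}.  Maximal minors
   of A are indexed by increasing choices f of d columns. *)
Definition positroid_on (E : {set 'I_n}) (M : matroid 'I_n) : Prop :=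
  ground M = E /\
  exists (m : nat) (e : 'I_m -> 'I_n) (d : nat) (A : 'M[R]_(d, m)),
    [/\ increasing e /\ e @: [set: 'I_m] = E,
        \rank A = d,
        forall f : 'I_d -> 'I_m,
          increasing f -> (0 <= \det (colsub f A))%R &
        bases M = [set e @: B | B : {set 'I_m}
                     in [pred B : {set 'I_m} |
                          basis_of fullv [seq col j A | j in B]]]].

End Positroids.

Section NonCrossing.
Variable n : nat.
Local Open Scope nat_scope.

(* Some rotation of (a, b, c, d) is strictly increasing. *)
Definition cyclically_ordered (a b c d : 'I_n) : bool :=
  [|| [&& a < b, b < c & c < d], [&& b < c, c < d & d < a],
      [&& c < d, d < a & a < b] | [&& d < a, a < b & b < c]].

Definition noncrossing_partition (P : {set {set 'I_n}}) : Prop :=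
  partition P [set: 'I_n] /\
  forall S S' : {set 'I_n}, S \in P -> S' \in P -> S != S' ->
    ~ exists a b c d : 'I_n,
        [/\ cyclically_ordered a b c d,
            a \in S, c \in S, b \in S' & d \in S'].

End NonCrossing.

(* Main.v *)
Require Import Defs.
From mathcomp Require Import all_boot all_order all_algebra.
From mathcomp Require Import reals.
From mathcomp Require Import all_fingroup zify ring.

(* Components of a positroid do not cross: if a connected matroid has elements
   on both sides of a cut of its ground set, some basis exchange x -> y crosses
   the cut.  If two components cross, this yields exchanges x -> y in one and
   x' -> y' in the other that cross as chords of the circle.  With K the rest of
   a common basis, Kxy is not a basis, so the Pluecker relation reads
   D(Kxx') D(Kyy') = D(Kxy') D(Kyx') with no factor zero; for crossing chords
   this contradicts the nonnegativity of the minors.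
   Conversely, add the blocks by increasing minimum: by non-crossing, no element
   of an earlier block lies strictly between two elements of the new one, so
   multiplying each old column to the right of the new block by (-1)^r, with r
   the rank of the new block, makes the minors of the block diagonal matrix
   nonnegative. *)

Set Implicit Arguments.
Unset Strict Implicit.
Unset Printing Implicit Defensive.

Import Order.TTheory GRing.Theory Num.Theory.
Local Open Scope ring_scope.

(** * Signs of maximal minors *)

Section MinorSigns.
Variable R : realFieldType.

Lemma det_colsub_perm d n (A : 'M[R]_(d, n)) (f : 'I_d -> 'I_n) (s : 'S_d) :
  \det (colsub (f \o s) A) = (-1) ^+ s * \det (colsub f A).
Proof.
have -> : colsub (f \o s) A = col_perm s (colsub f A).
  by apply/matrixP => i j; rewrite !mxE.
by rewrite col_permE det_mulmx det_perm odd_permV mulrC.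
Qed.

Lemma det_colsub_inj d n (A : 'M[R]_(d, n)) (f : 'I_d -> 'I_n) :
  \det (colsub f A) != 0 -> injective f.
Proof.
move=> Dn0 i j fij; apply/eqP; apply: contraNT Dn0 => ij.
rewrite -det_tr; apply/eqP/(determinant_alternate ij) => k.
by rewrite !mxE fij.
Qed.

(* Changes sign under permutations of f exactly as the minor of columns f does,
   and is positive on increasing f; hence the product of both does not depend on
   the order of the columns and has the sign of the maximal minor. *)
Definition vdm d n (f : 'I_d -> 'I_n) : R :=
  \det (Vandermonde d (\row_j (f j)%:R)).

Lemma vdm_perm d n (f : 'I_d -> 'I_n) (s : 'S_d) :
  vdm (f \o s) = (-1) ^+ s * vdm f.
Proof.
pose W : 'M[R]_(d, n) := \matrix_(i, j) (j%:R ^+ i).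
suff E g : vdm g = \det (colsub g W) by rewrite !E det_colsub_perm.
by congr (\det _); apply/matrixP => i j; rewrite !mxE.
Qed.

Lemma vdmE d n (f : 'I_d -> 'I_n) :
  vdm f = \prod_(i < d) \prod_(j < d | (i < j)%N) ((f j)%:R - (f i)%:R).
Proof.
rewrite /vdm det_Vandermonde; apply: eq_bigr => i _; apply: eq_bigr => j _.
by rewrite !mxE.
Qed.

Lemma vdm_increasing d n (f : 'I_d -> 'I_n) : increasing f -> 0 < vdm f.
Proof.
move=> inc; rewrite vdmE; apply: prodr_gt0 => i _; apply: prodr_gt0 => j ij.
by rewrite subr_gt0 ltr_nat; apply: inc.
Qed.

Lemma perm_of_same_image (T : finType) d (f g : 'I_d -> T) :
  injective f -> injective g -> f @: [set: 'I_d] = g @: [set: 'I_d] ->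
  exists s : 'S_d, g =1 f \o s.
Proof.
move=> fI gI fg.
have ex i : exists j, g i == f j.
  have : g i \in f @: [set: 'I_d] by rewrite fg imset_f.
  by case/imsetP => j _ ->; exists j.
pose h i := xchoose (ex i).
have hE i : g i = f (h i) by apply/eqP; apply: (xchooseP (ex i)).
have hI : injective h by move=> i j hij; apply: gI; rewrite !hE hij.
by exists (perm hI) => i; rewrite /= permE hE.
Qed.

(** The enumeration of a set filters the sorted list of all ordinals. *)
Lemma enum_val_increasing n (B : {set 'I_n}) : increasing (@enum_val _ (mem B)).
Proof.
move=> i j ij; have x0 := enum_val i; rewrite !(enum_val_nth x0).
have srt : sorted ltn (map val (enum B)).
  rewrite sorted_map; apply: sorted_filter; first by move=> ? ? ?; apply: ltn_trans.
  by rewrite -enumT -sorted_map val_enum_ord iota_ltn_sorted.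
have := sorted_ltn_nth ltn_trans 0%N srt.
move=> /(_ i j); rewrite !inE size_map -cardE !ltn_ord => /(_ isT isT ij).
by rewrite !(nth_map x0) // -cardE.
Qed.

Lemma increasing_inj d n (f : 'I_d -> 'I_n) : increasing f -> injective f.
Proof.
move=> inc i j fij; apply/val_inj.
by case: (ltngtP i j) => // /inc; rewrite fij ltnn.
Qed.

Lemma increasing_sort d n (f : 'I_d -> 'I_n) :
  injective f -> exists s : 'S_d, increasing (f \o s).
Proof.
move=> fI; set B := f @: [set: 'I_d].
have cB : d = #|B| by rewrite card_imset // cardsT card_ord.
pose g (i : 'I_d) : 'I_n := enum_val (cast_ord cB i).
have ginc : increasing g by move=> i j ij; apply: enum_val_increasing.
have gB : B = g @: [set: 'I_d].
  apply/esym/eqP; rewrite eqEcard; apply/andP; split.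
    by apply/subsetP => _ /imsetP[i _ ->]; apply: enum_valP.
  rewrite -cB card_imset ?cardsT ?card_ord //; exact: increasing_inj.
have [s sE] := perm_of_same_image fI (increasing_inj ginc) gB.
by exists s => i j ij; rewrite -!sE; apply: ginc.
Qed.

Lemma eq_det_colsub n d (A : 'M[R]_(d, n)) (f g : 'I_d -> 'I_n) :
  f =1 g -> \det (colsub f A) = \det (colsub g A).
Proof. by move=> fg; congr (\det _); apply/matrixP => i j; rewrite !mxE fg. Qed.

Lemma eq_vdm n d (f g : 'I_d -> 'I_n) : f =1 g -> vdm f = vdm g.
Proof. by move=> fg; congr (\det _); apply/matrixP => i j; rewrite !mxE fg. Qed.

(** Letting [f] range over all column choices, with [vdm] correcting the sign, makes it possible to
    reorder columns freely. The columns are indexed by all of ['I_n], so that matroids on different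
    ground sets can share one matrix. *)
Definition nonneg_rep n d (A : 'M[R]_(d, n)) (Bs : {set {set 'I_n}}) : Prop :=
  (forall f : 'I_d -> 'I_n, 0 <= \det (colsub f A) * vdm f) /\
  forall B, B \in Bs <->
    exists2 f : 'I_d -> 'I_n, \det (colsub f A) != 0 & f @: [set: 'I_d] = B.

(** Injective choices with the same image have minors that differ by a permutation sign, so
    vanishing depends on the column set alone. *)
Lemma nonneg_rep_neq0 n d (A : 'M[R]_(d, n)) Bs (f : 'I_d -> 'I_n) :
  nonneg_rep A Bs -> injective f ->
  (\det (colsub f A) != 0) = (f @: [set: 'I_d] \in Bs).
Proof.
move=> [_ Bsp] fI; apply/idP/idP => [Dn0|]; first by apply/Bsp; exists f.
case/Bsp => g Dg gf.
have [s sE] := perm_of_same_image (det_colsub_inj Dg) fI gf.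
by rewrite (eq_det_colsub _ sE) det_colsub_perm mulf_neq0 // signr_eq0.
Qed.

Lemma det_vdm_perm n d (A : 'M[R]_(d, n)) (f : 'I_d -> 'I_n)
    (s : 'S_d) :
  \det (colsub (f \o s) A) * vdm (f \o s) = \det (colsub f A) * vdm f.
Proof.
by rewrite det_colsub_perm vdm_perm mulrACA -signr_addb addbb mul1r.
Qed.

Lemma det_colsub_support n d (A : 'M[R]_(d, n)) (E : {set 'I_n})
    (f : 'I_d -> 'I_n) :
  (forall i j, j \notin E -> A i j = 0) -> \det (colsub f A) != 0 ->
  forall j, f j \in E.
Proof.
move=> A0 + j; apply: contraNT => fj; apply/eqP.
rewrite (expand_det_col _ j) big1 // => i _.
by rewrite mxE A0 // mul0r.
Qed.

Lemma vdm_neq0 d n (f : 'I_d -> 'I_n) : injective f -> vdm f != 0.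
Proof.
move=> fI; have [s inc] := increasing_sort fI.
have := vdm_increasing inc; rewrite vdm_perm => /gt_eqF/negbT.
by rewrite mulf_eq0 signr_eq0.
Qed.

Lemma nonneg_rep_gt0 n d (A : 'M[R]_(d, n)) Bs (f : 'I_d -> 'I_n) :
  nonneg_rep A Bs -> injective f -> f @: [set: 'I_d] \in Bs ->
  0 < \det (colsub f A) * vdm f.
Proof.
move=> rA fI fB; rewrite lt_neqAle (proj1 rA) andbT eq_sym mulf_neq0 //.
  by rewrite (nonneg_rep_neq0 rA).
exact: vdm_neq0.
Qed.

(** * Column bases and nonzero minors *)

Lemma free_det d (X : d.-tuple 'cV[R]_d) :
  free X = (\det (\matrix_(i, j) tnth X j i 0) != 0).
Proof.
set W := \matrix_(i, j) _.
(* Linear relations among the vectors of [X] are kernel vectors of [W]. *)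
have WE k : W *m (\col_i k i) = \sum_(i < d) k i *: X`_i.
  apply/matrixP => a b; rewrite !mxE summxE ord1; apply: eq_bigr => i _.
  by rewrite !mxE mulrC (tnth_nth 0).
have -> : (\det W != 0) = (W \in unitmx) by rewrite unitmxE unitfE.
apply/freeP/idP => [fr|Wu k].
  rewrite -unitmx_tr -row_free_unit -kermx_eq0; apply/eqP/row_matrixP => i.
  rewrite row0; set v := row i _.
  have vW : v *m W^T = 0 by apply/sub_kermxP/row_sub.
  have: W *m v^T = 0 by rewrite -[W]trmxK -trmx_mul vW trmx0.
  have vE : v^T = \col_i v 0 i.
    by apply/colP => a; rewrite mxE [LHS]mxE.
  rewrite vE.
  by rewrite WE => /fr v0; apply/rowP => j; rewrite v0 mxE.
rewrite -WE => W0 i; have := mulKmx Wu (\col_i k i).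
by rewrite W0 mulmx0 => /matrixP/(_ i 0); rewrite !mxE => <-.
Qed.

(** The definition of a positroid lists the columns in the order of the enumerated set, a minor
    lists them in the order of [f]; freeness is invariant under this reordering. *)
Lemma perm_map_image (aT : finType) (rT : eqType) d (h : aT -> rT)
    (f : 'I_d -> aT) :
  injective f ->
  perm_eq [seq h j | j in f @: [set: 'I_d]] [seq h (f i) | i <- enum 'I_d].
Proof.
move=> fI; rewrite (map_comp h f) /image_mem perm_map // uniq_perm ?enum_uniq //.
  by rewrite map_inj_uniq ?enum_uniq.
move=> x; rewrite mem_enum; apply/imsetP/mapP => -[i _ ->]; exists i => //.
by rewrite mem_enum.
Qed.

(** Bridge from [basis_of] to minors: the dimension forces [d] elements in [B], and [d] columns form
    a basis exactly when they are free. *)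
Lemma basis_of_colsP d n (A : 'M[R]_(d, n)) (B : {set 'I_n}) :
  basis_of fullv [seq col j A | j in B] <->
  exists2 f : 'I_d -> 'I_n, \det (colsub f A) != 0 & f @: [set: 'I_d] = B.
Proof.
have freeE (f : 'I_d -> 'I_n) :
    free [seq col (f i) A | i <- enum 'I_d] = (\det (colsub f A) != 0).
  rewrite (_ : [seq _ | i <- _] = [tuple col (f i) A | i < d]); last first.
    by [].

  rewrite free_det; congr (\det _ != 0).
  by apply/matrixP => i j; rewrite !mxE tnth_mktuple !mxE.
have dimf : \dim {:'cV[R]_d} = d by rewrite dimvf /dim /= muln1.
split=> [bB|[f Df fB]].
  have cB : d = #|B|.
    have [fr spB] := (basis_free bB, span_basis bB).
    by move: fr; rewrite /free spB dimf size_map -cardE => /eqP.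
  pose g (i : 'I_d) : 'I_n := enum_val (cast_ord cB i).
  have gI : injective g.
    by move=> i j /enum_val_inj/cast_ord_inj.
  have gB : g @: [set: 'I_d] = B.
    apply/eqP; rewrite eqEcard card_imset // cardsT card_ord -cB leqnn andbT.
    by apply/subsetP => _ /imsetP[i _ ->]; apply: enum_valP.
  exists g => //; rewrite -freeE.
  move: bB; rewrite basisEfree => /and3P[+ _ _].
  by rewrite -gB (perm_free (perm_map_image _ gI)).
have fI := det_colsub_inj Df.
move: Df; rewrite -freeE => fr.
have pe := perm_map_image (fun j => col j A) fI; rewrite fB in pe.
rewrite -(perm_free pe) in fr.
rewrite basisEdim (perm_size pe) size_map size_enum_ord dimf leqnn andbT.
have/eqP -> : (<<[seq col j A | j in B]>> == {:'cV[R]_d})%VS.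
  by rewrite eqEdim subvf (eqP fr) (perm_size pe) size_map size_enum_ord dimf leqnn.
by [].
Qed.

End MinorSigns.

Local Close Scope ring_scope.

(** * Connectedness and cuts of the ground set *)

Section MatroidCuts.
Variable T : finType.
Implicit Types (M : matroid T) (B X : {set T}).

Lemma bases_neq0 M : exists B, B \in bases M.
Proof. by case/and3P: (matroidP M) => /set0Pn. Qed.

Lemma basis_sub M B : B \in bases M -> B \subset ground M.
Proof. by case/and3P: (matroidP M) => _ /forall_inP/(_ B). Qed.

Lemma basis_exchange M B1 B2 x :
  B1 \in bases M -> B2 \in bases M -> x \in B1 :\: B2 ->
  exists2 y, y \in B2 :\: B1 & (y |: (B1 :\ x)) \in bases M.
Proof.
move=> B1M B2M xB; case/and3P: (matroidP M) => _ _ /forall_inP/(_ B1 B1M).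
by move=> /forall_inP/(_ B2 B2M)/forall_inP/(_ x xB)/exists_inP.
Qed.

Lemma basis_antichain M B1 B2 :
  B1 \in bases M -> B2 \in bases M -> B1 \subset B2 -> B1 = B2.
Proof.
move=> B1M B2M sB; apply/eqP; rewrite eqEsubset sB /=.
apply: contraT => /subsetPn[x xB2 xB1].
have [|y] := @basis_exchange M B2 B1 x B2M B1M; first by rewrite inE xB1.
by rewrite inE => /andP[yB2 /(subsetP sB)]; rewrite (negPf yB2).
Qed.

Lemma matroid_eq M1 M2 : ground M1 = ground M2 -> bases M1 = bases M2 -> M1 = M2.
Proof.
case: M1 M2 => [E1 Bs1 P1] [E2 Bs2 P2] /= eE eB.
by move: P1 P2; rewrite eE eB => P1 P2; rewrite (bool_irrelevance P1 P2).
Qed.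

(** Separability in terms of exchanges: under this condition the matroid splits along [X], as
    [respects_cut_sum] shows. *)
Definition respects_cut M X : Prop :=
  forall B x y, B \in bases M -> x \in B -> y \notin B ->
    y |: (B :\ x) \in bases M -> (x \in X) = (y \in X).

Lemma cut_exchange M X B1 B2 x :
  respects_cut M X -> B1 \in bases M -> B2 \in bases M -> x \in B1 :\: B2 ->
  exists y, [/\ y \in B2 :\: B1, (y |: (B1 :\ x)) \in bases M
              & (x \in X) = (y \in X)].
Proof.
move=> cutX B1M B2M xB; have [y yB yM] := basis_exchange B1M B2M xB.
exists y; split=> //; move: xB yB; rewrite !inE => /andP[_ xB] /andP[yB _].
exact: (cutX B1).
Qed.

(* Induction on the number of exchanges outside X that turn B1 into B2. *)
Lemma cut_glue M X B1 B2 :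
  respects_cut M X -> B1 \in bases M -> B2 \in bases M ->
  (B1 :&: X) :|: (B2 :\: X) \in bases M.
Proof.
move=> cutX; move: {2}_.+1 (ltnSn #|(B1 :\: B2) :\: X|) => k.
elim: k => // k IH in B1 *; rewrite ltnS => lek B1M B2M.
have [/eqP D0|/set0Pn[x]] := boolP ((B1 :\: B2) :\: X == set0).
  suff <- : B1 = B1 :&: X :|: B2 :\: X by [].
  apply/setP => z; rewrite !inE; have [|zX] /= := boolP (z \in X).
    by rewrite andbT orbF.
  rewrite andbF /=; apply/idP/idP => [zB1|zB2]; apply: contraT => zN.
    by move/setP/(_ z): D0; rewrite !inE zX zN zB1.
  have [|y []] := cut_exchange (x := z) cutX B2M B1M; first by rewrite inE zN.
  rewrite (negPf zX) => yB _ /esym/negbT yX.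
  by move/setP/(_ y): D0; rewrite in_setD yX yB inE.
rewrite in_setD => /andP[xX xB].
have [y [yB yM yX]] := cut_exchange cutX B1M B2M xB.
rewrite (negPf xX) in yX; move/esym/negbT in yX.
move: xB yB; rewrite !inE => /andP[xB2 xB1] /andP[yB1 yB2].
have -> : B1 :&: X = (y |: (B1 :\ x)) :&: X.
  apply/setP => z; rewrite !inE; have [->|_] /= := eqVneq z y.
    by rewrite (negPf yX) !andbF.
  by have [->|_] /= := eqVneq z x; rewrite // (negPf xX) !andbF.
apply: IH => //; apply: leq_trans lek; apply: proper_card.
apply/properP; split; last first.
  exists x; rewrite !inE ?eqxx ?xX ?xB2 ?xB1 ?andbF ?orbF //=.
  by apply: contraNN xB2 => /eqP->.
apply/subsetP => z; rewrite !inE; have [->|_] /= := eqVneq z y.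
  by rewrite yB2 andbF.
by case: (z == x); rewrite ?andbF.
Qed.

(** An exchange that removes an element of [X] must insert an element of [X], so it restricts to the
    traces on [X]. *)
Lemma cut_part_subproof M X :
  respects_cut M X ->
  matroid_axiom (ground M :&: X) [set B :&: X | B in bases M].
Proof.
move=> cutX; apply/and3P; split.
- have [B BM] := bases_neq0 M.
  by apply/set0Pn; exists (B :&: X); apply: imset_f.
- by apply/forall_inP => _ /imsetP[B BM ->]; rewrite setSI // basis_sub.
apply/forall_inP => _ /imsetP[B1 B1M ->].
apply/forall_inP => _ /imsetP[B2 B2M ->].
apply/forall_inP => x; rewrite !inE => /andP[+ /andP[xB1 xX]].
rewrite xX andbT => xB2.
have [|y [yB yM]] := cut_exchange (x := x) cutX B1M B2M; first by rewrite inE xB2.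
rewrite xX => /esym yX.
apply/exists_inP; exists y.
  by move: yB; rewrite !inE yX !andbT.
apply/imsetP; exists (y |: (B1 :\ x)) => //.
apply/setP => z; rewrite !inE; have [->|_] /= := eqVneq z y; first by rewrite yX.
by rewrite andbA.
Qed.

Lemma respects_cutC M X : respects_cut M X -> respects_cut M (~: X).
Proof. by move=> cutX B x y BM xB yB /(cutX _ _ _ BM xB yB); rewrite !inE => ->. Qed.

(** By [cut_glue], a trace on [X] of one basis and a trace on the complement of another always
    combine to a basis. *)
Lemma respects_cut_sum M X (cutX : respects_cut M X) :
  let N b := if b then Matroid (cut_part_subproof cutX)
             else Matroid (cut_part_subproof (respects_cutC cutX)) in
  exists dis : disjoint_grounds N, M = direct_sum dis.
Proof.
move=> N.
have dis : disjoint_grounds N.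
  apply/forallP => i; apply/forallP => j; apply/implyP.
  by case: i; case: j => //= _; apply/pred0P => z /=; rewrite !inE;
    case: (z \in X); rewrite ?andbF.
have U (F : bool -> {set T}) : \bigcup_b F b = F true :|: F false.
  by apply/setP => z; rewrite inE; apply/bigcupP/orP => [[[] _ ->]|[]]; eauto.
exists dis; apply: matroid_eq => /=.
  by rewrite /sum_ground U /= -setDE setID.
apply/setP => B; apply/idP/imsetP => [BM|[f /familyP fP ->]].
  exists [ffun b => if b then B :&: X else B :&: ~: X].
    by apply/familyP => -[]; rewrite ffunE; exact: (imset_f (fun B => B :&: _) BM).
  by rewrite U !ffunE -setDE setID.
have /imsetP[B1 B1M f1] := fP true; have /imsetP[B2 B2M f2] := fP false.
by rewrite U f1 f2 -setDE; apply: cut_glue.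
Qed.

(** Otherwise the matroid splits along [X], and [u] and [v] show that both summands have nonempty
    ground sets. *)
Lemma connected_cut M X u v :
  connected M -> u \in ground M -> v \in ground M -> u \in X -> v \notin X ->
  exists B x y, [/\ B \in bases M, x \in B, y \notin B,
    y |: (B :\ x) \in bases M & (x \in X) != (y \in X)].
Proof.
move=> conM uM vM uX vX.
have [/exists_inP[B BM /exists_inP[x xB /exists_inP[y yB /andP[]]]]|noex] :=
  boolP [exists B in bases M, exists x in B, exists y in ~: B,
    (y |: (B :\ x) \in bases M) && ((x \in X) != (y \in X))].
  by rewrite inE in yB; exists B, x, y.
have cutX : respects_cut M X.
  move=> B x y BM xB yB yM; apply/eqP; apply: contraNT noex => xy.
  apply/exists_inP; exists B => //; apply/exists_inP; exists x => //.
  by apply/exists_inP; exists y; rewrite ?inE // yM.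
case: conM; have [dis E] := respects_cut_sum cutX.
set N := (fun _ => _) in dis E; exists N, dis; split=> // -[]; apply/set0Pn.
  by exists u; rewrite inE uM.
by exists v; rewrite !inE vM.
Qed.

End MatroidCuts.

Local Open Scope ring_scope.

(** * The three-term Pluecker relation *)

Definition ord_cons (T : Type) d (p : T) (k : 'I_d -> T) (i : 'I_d.+1) : T :=
  oapp k p (unlift ord0 i).

Section OrdCons.
Variable T : finType.
Implicit Types (p : T) (d : nat).

Lemma ord_cons0 d p (k : 'I_d -> T) : ord_cons p k ord0 = p.
Proof. by rewrite /ord_cons unlift_none. Qed.

Lemma ord_consS d p (k : 'I_d -> T) i : ord_cons p k (lift ord0 i) = k i.
Proof. by rewrite /ord_cons liftK. Qed.

Lemma ord_cons_image d p (k : 'I_d -> T) :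
  ord_cons p k @: [set: 'I_d.+1] = p |: (k @: [set: 'I_d]).
Proof.
apply/setP => z; apply/imsetP/setU1P => [[i _ ->]|[->|/imsetP[i _ ->]]].
- case: (unliftP ord0 i) => [j ->|->]; rewrite ?ord_cons0 ?ord_consS; last by left.
  by right; apply: imset_f.
- by exists ord0; rewrite ?ord_cons0.
- by exists (lift ord0 i); rewrite ?ord_consS.
Qed.

Lemma ord_cons_inj d p (k : 'I_d -> T) :
  injective k -> p \notin k @: [set: 'I_d] -> injective (ord_cons p k).
Proof.
move=> kI pk i j.
case: (unliftP ord0 i) => [i' ->|->]; case: (unliftP ord0 j) => [j' ->|->];
  rewrite ?ord_cons0 ?ord_consS // => e.
- by rewrite (kI _ _ e).
- by rewrite -e imset_f in pk.
- by rewrite e imset_f in pk.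
Qed.

End OrdCons.

Section Pluecker.
Variables (R : realFieldType) (n : nat).

Lemma vdm_cons d (p : 'I_n) (k : 'I_d -> 'I_n) :
  vdm R (ord_cons p k) = \prod_j ((k j)%:R - p%:R) * vdm R k.
Proof.
rewrite !vdmE big_ord_recl; congr (_ * _).
  rewrite big_mkcond big_ord_recl /= mul1r.
  by apply: eq_bigr => j _; rewrite ord_cons0 ord_consS.
apply: eq_bigr => i _; rewrite big_mkcond big_ord_recl /= mul1r.
rewrite [RHS]big_mkcond; apply: eq_bigr => j _.
by rewrite !ord_consS /bump /= !add1n ltnS.
Qed.

(** Multiplying by the inverse of the submatrix on [x], [x'], [k] turns these columns into unit
    vectors; the first two rows of the result are [u] and [v]. *)
Lemma det_two_columns d (A : 'M[R]_(d.+2, n)) (k : 'I_d -> 'I_n) (x x' : 'I_n) :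
  let D p q := \det (colsub (ord_cons p (ord_cons q k)) A) in
  D x x' != 0 -> exists u v : 'I_n -> R,
    [/\ forall p q, D p q = D x x' * (u p * v q - u q * v p),
        u x = 1, v x = 0, u x' = 0 & v x' = 1].
Proof.
move=> D Dn0; set f0 := ord_cons x (ord_cons x' k).
pose M0 := colsub f0 A; have M0u : M0 \in unitmx by rewrite unitmxE unitfE.
have [W WA W0] : exists2 W, M0 *m W = A & forall i j, W i (f0 j) = (i == j)%:R.
  exists (invmx M0 *m A) => [|i j]; first by rewrite mulKVmx.
  have : colsub f0 (invmx M0 *m A) = 1%:M by rewrite -mulmx_colsub mulVmx.
  by move/matrixP/(_ i j); rewrite mxE => ->; rewrite mxE.
have Wx i : W i x = (i == ord0)%:R by rewrite -W0 /f0 ord_cons0.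
have Wx' i : W i x' = (i == lift ord0 ord0)%:R by rewrite -W0 /f0 ord_consS ord_cons0.
have Wk i j : W i (k j) = (i == lift ord0 (lift ord0 j))%:R.
  by rewrite -W0 /f0 !ord_consS.
exists (W ord0), (W (lift ord0 ord0)); split; rewrite ?Wx ?Wx' //.
move=> p q; have -> : D p q = \det (M0 *m colsub (ord_cons p (ord_cons q k)) W).
  by rewrite mulmx_colsub WA.
rewrite det_mulmx; congr (_ * _).
(* The columns of [k] are the last [d] unit vectors, so [V] is block triangular and only its upper
   left block of size 2 contributes. *)
set V : 'M_(2 + d) := colsub _ W.
have V12 : ursubmx V = 0.
  apply/matrixP => i j; rewrite !mxE.
  have -> : rshift 2 j = lift ord0 (lift ord0 j) by apply/val_inj.
  rewrite !ord_consS Wk; case: i => -[|[|]] //= i2; rewrite ?(negPf _) //.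
have V22 : drsubmx V = 1%:M.
  apply/matrixP => i j; rewrite !mxE.
  have E h : rshift 2 h = lift ord0 (lift ord0 h) by apply/val_inj.
  by rewrite !E !ord_consS Wk !(inj_eq lift_inj).
have -> : \det V = \det (ulsubmx V).
  by rewrite -{1}[V]submxK V12 V22 det_lblock det1 mulr1.
rewrite (expand_det_row _ ord0) big_ord_recl big_ord1 /cofactor.
rewrite !det_mx11 !mxE /=.
have -> : lshift d (@ord0 1) = ord0 by apply/val_inj.
have -> : lshift d (lift ord0 0 : 'I_2) = lift ord0 ord0 by apply/val_inj.
have -> : lshift d (lift (lift ord0 ord0) 0 : 'I_2) = ord0 by apply/val_inj.
rewrite !ord_consS !ord_cons0 /bump /= addn0 expr0 expr1.
by ring.
Qed.

(** The conclusion says that the chords [x y] and [x' y'] do not cross. It comes from multiplying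
    the four positive products of a minor with its [vdm]. *)
Lemma nonneg_rep_not_crossing d (A : 'M[R]_(d, n)) Bs (K : {set 'I_n})
    (x y x' y' : 'I_n) :
  nonneg_rep A Bs -> x \notin K -> y \notin K -> x' \notin K -> y' \notin K ->
  x != x' -> x != y' -> y != x' -> y != y' -> x != y ->
  x |: (x' |: K) \in Bs -> x |: (y' |: K) \in Bs ->
  y |: (x' |: K) \in Bs -> y |: (y' |: K) \in Bs ->
  x |: (y |: K) \notin Bs ->
  0 < (x'%:R - x%:R) * (y'%:R - x%:R) * (x'%:R - y%:R) * (y'%:R - y%:R) :> R.
Proof.
move=> rA xK yK x'K y'K xx' xy' yx' yy' xy Bxx' Bxy' Byx' Byy' Bxy.
(* The size of a basis fixes [d]; rewriting it as [#|K|.+2] lets two columns be put in front of an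
   enumeration of [K]. *)
have {A rA} [A rA] : exists A : 'M[R]_(#|K|.+2, n), nonneg_rep A Bs.
  suff e : d = #|K|.+2 by rewrite -e; exists A.
  case: (rA) => _ /(_ (x |: (x' |: K)))/proj1/(_ Bxx')[f /det_colsub_inj fI fB].
  move/(congr1 (fun B : {set _} => #|B|)): fB.
  rewrite card_imset // cardsT card_ord => ->.
  by rewrite !cardsU1 x'K !inE negb_or xx' xK.
pose k (i : 'I_#|K|) : 'I_n := enum_val i.
have kI : injective k by apply: enum_val_inj.
have kK : k @: [set: 'I_#|K|] = K.
  apply/setP => z; apply/imsetP/idP => [[i _ ->]|zK]; first exact: enum_valP.
  by exists (enum_rank_in zK z) => //; rewrite /k enum_rankK_in.
pose F p q := ord_cons p (ord_cons q k).
have FI p q : p \notin K -> q \notin K -> p != q -> injective (F p q).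
  move=> pK qK pq; apply: ord_cons_inj; last first.
    by rewrite ord_cons_image kK !inE negb_or pq pK.
  by apply: ord_cons_inj; rewrite ?kK.
have FB p q : F p q @: [set: 'I_#|K|.+2] = p |: (q |: K).
  by rewrite !ord_cons_image kK.
pose D p q := \det (colsub (F p q) A).
pose c (p : 'I_n) : R := \prod_j ((k j)%:R - p%:R).
have VF p q : vdm R (F p q) = (q%:R - p%:R) * c p * (c q * vdm R k).
  rewrite !vdm_cons; congr (_ * _); rewrite big_ord_recl ord_cons0.
  by congr (_ * _); apply: eq_bigr => j _; rewrite ord_consS.
have Fgt0 p q : p \notin K -> q \notin K -> p != q -> p |: (q |: K) \in Bs ->
    0 < D p q * ((q%:R - p%:R) * c p * (c q * vdm R k)).
  move=> pK qK pq pqB; rewrite -VF; apply: (nonneg_rep_gt0 rA); first exact: FI.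
  by rewrite FB.
have Dn0 : D x x' != 0 by rewrite (nonneg_rep_neq0 rA) ?FB //; apply: FI.
(* Modulo the span of K and in the basis x, x', column p is (u p, v p). *)
have [u [v [DE ux vx ux' vx']]] := det_two_columns Dn0.
have Dxy : D x y = 0.
  by apply/eqP; move: Bxy; rewrite -FB -(nonneg_rep_neq0 rA) ?negbK //; apply: FI.
have vy : v y = 0.
  move: Dxy; rewrite /D DE ux vx mul1r mulr0 subr0 => /eqP.
  by rewrite mulf_eq0 (negPf Dn0) => /eqP.
have := mulr_gt0 (mulr_gt0 (Fgt0 _ _ xK x'K xx' Bxx') (Fgt0 _ _ yK y'K yy' Byy'))
  (mulr_gt0 (Fgt0 _ _ xK y'K xy' Bxy') (Fgt0 _ _ yK x'K yx' Byx')).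
rewrite /D (DE y y') (DE x y') (DE y x') ux vx ux' vx' vy.
rewrite -/(D x x'); set D0 := D x x'; set w := vdm R k.
set G := (X in _ -> 0 < X); set H := (X in 0 < X -> _).
(* Since [v y = 0], the minors satisfy [D x x' * D y y' = D x y' * D y x'], so their product is a
   square; each factor [c] occurs twice and [w] four times. Only the four differences in [G] can
   carry a sign. *)
have -> : H = (D0 ^+ 2 * u y * v y' * c x * c x' * c y * c y' * w ^+ 2) ^+ 2 * G.
  by rewrite /H /G; ring.
move=> H0; rewrite ltNge; apply: contraTN H0 => G0; rewrite -leNgt.
by rewrite mulr_ge0_le0 // sqr_ge0.
Qed.

End Pluecker.

(** * Positroids and totally nonnegative matrices *)

Section Representation.
Variables (R : realType) (n : nat).

(** The columns move to their places in ['I_n] along [e], and zero columns fill the rest; a minor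
    using a zero column vanishes, so no bases are added. *)
Lemma positroid_nonneg_rep (E : {set 'I_n}) (M : matroid 'I_n) :
  positroid_on R E M ->
  exists d (A : 'M[R]_(d, n)),
    nonneg_rep A (bases M) /\ forall i j, j \notin E -> A i j = 0.
Proof.
case=> _ [m [e [d [A [[einc eE] _ Age0 basesE]]]]].
have eI := increasing_inj einc.
pose A' : 'M[R]_(d, n) := A *m \matrix_(k, j) (e k == j)%:R.
have A'e i k : A' i (e k) = A i k.
  rewrite !mxE (bigD1 k) //= big1 ?mxE ?eqxx ?mulr1 ?addr0 // => l lk.
  by rewrite !mxE (inj_eq eI) (negPf lk) mulr0.
have A'0 i j : j \notin E -> A' i j = 0.
  move=> jE; rewrite !mxE big1 // => l _; rewrite !mxE.
  by case: eqP jE => [<-|]; rewrite ?mulr0 // -eE imset_f.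
have A'eg (g : 'I_d -> 'I_m) : colsub (e \o g) A' = colsub g A.
  by apply/matrixP => i j; rewrite mxE A'e mxE.
have lift_e f : \det (colsub f A') != 0 -> exists g, f =1 e \o g.
  move=> Df; have fE j : exists k, f j == e k.
    have := det_colsub_support A'0 Df j; rewrite -eE => /imsetP[k _ ->].
    by exists k.
  exists (fun j => xchoose (fE j)) => j; exact/eqP/(xchooseP (fE j)).
exists d, A'; split=> //; split=> [f|B].
  have [->|Df] := eqVneq (\det (colsub f A')) 0; first by rewrite mul0r.
  have [s finc] := increasing_sort (det_colsub_inj Df).
  have [g fg] := lift_e _ Df.
  (* An increasing [e] also reflects the order. *)
  have ginc : increasing (g \o s).
    move=> i j /finc; rewrite /= !fg /=.
    by case: (ltngtP (g (s i)) (g (s j))) => // [/einc|/val_inj->];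
      rewrite ?ltnn // ltnNge => /negbTE eij /ltnW; rewrite eij.
  rewrite -(det_vdm_perm _ _ s) mulr_ge0 //; last exact/ltW/vdm_increasing.
  rewrite (eq_det_colsub _ (g := e \o (g \o s))) => [|i]; last by rewrite /= fg.
  by rewrite A'eg Age0.
rewrite basesE; split.
  case/imsetP => B' /basis_of_colsP[g Dg gB'] ->.
  by exists (e \o g); rewrite ?A'eg // imset_comp gB'.
case=> f Df fB; have [g fg] := lift_e _ Df.
have -> : B = e @: (g @: [set: 'I_d]).
  by rewrite -fB -imset_comp; apply: eq_imset.
apply: imset_f; apply/basis_of_colsP; exists g => //.
by rewrite -A'eg -(eq_det_colsub _ fg).
Qed.

Lemma nonneg_rep_positroid (M : matroid 'I_n) d (A : 'M[R]_(d, n)) :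
  ground M = [set: 'I_n] -> nonneg_rep A (bases M) -> positroid_on R [set: 'I_n] M.
Proof.
move=> gM rA; split=> //; exists n, id, d, A; split.
- by split=> //; rewrite imset_id.
(* Some basis exists, and its nonzero maximal minor gives full row rank. *)
- have [B /(proj2 rA)[f Df _]] := bases_neq0 M.
  apply/eqP; rewrite eqn_leq rank_leq_row /=.
  have e : colsub f A = A *m colsub f 1%:M by rewrite mulmx_colsub mulmx1.
  have /mxrank_unit rk : colsub f A \in unitmx by rewrite unitmxE unitfE.
  by have := mxrankM_maxl A (colsub f 1%:M); rewrite -e rk.
- move=> f finc; have := proj1 rA f.
  by rewrite pmulr_lge0 // vdm_increasing.
- apply/setP => B; apply/idP/imsetP => [BM|[B' bB ->]]; rewrite ?imset_id.
    by exists B; rewrite ?imset_id // inE; apply/basis_of_colsP/(proj2 rA).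
  by apply/(proj2 rA)/basis_of_colsP; rewrite inE in bB.
Qed.

End Representation.

Local Close Scope ring_scope.

(** * Components do not cross *)

Section DirectSums.
Variables (T I : finType) (M : I -> matroid T).
Hypothesis dis : disjoint_grounds M.

Lemma disjoint_groundsP i j x : x \in ground (M i) -> x \in ground (M j) -> i = j.
Proof.
move=> xi xj; apply/eqP; apply: contraT => ij.
move/forallP: dis => /(_ i)/forallP/(_ j); rewrite ij => /pred0P/(_ x) /=.
by rewrite xi xj.
Qed.

(** As the ground sets are disjoint, the family behind a basis of the sum can be recovered as its
    traces, which removes the choice of a family. *)
Lemma mem_sum_bases (B : {set T}) :
  (B \in sum_bases M) =
  (B \subset sum_ground M) && [forall i, B :&: ground (M i) \in bases (M i)].
Proof.
apply/imsetP/andP => [[f /familyP fP ->]|[Bsub /forallP BP]].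
  split.
    apply/bigcupsP => i _.
    exact: subset_trans (basis_sub (fP i)) (bigcup_sup i _).
  apply/forallP => i; suff -> : (\bigcup_j f j) :&: ground (M i) = f i by apply: fP.
  apply/setP => z; rewrite inE; apply/andP/idP => [[/bigcupP[j _ zj] zi]|zi].
    by rewrite -(disjoint_groundsP (subsetP (basis_sub (fP j)) z zj) zi).
  by split; [apply/bigcupP; exists i | apply: (subsetP (basis_sub (fP i)))].
exists [ffun i => B :&: ground (M i)].
  by apply/familyP => i; rewrite ffunE.
apply/setP => z; apply/idP/bigcupP => [zB|[i _]]; last by rewrite ffunE inE => /andP[].
by have /bigcupP[i _ zi] := subsetP Bsub z zB; exists i; rewrite // ffunE inE zB.
Qed.

(** The exchange alters the trace on the [i]-th ground set only. *)
Lemma sum_bases_exchange W i x y :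
  W \in sum_bases M -> x \in ground (M i) -> y \in ground (M i) ->
  y |: ((W :&: ground (M i)) :\ x) \in bases (M i) ->
  y |: (W :\ x) \in sum_bases M.
Proof.
rewrite !mem_sum_bases => /andP[Wsub /forallP WP] xi yi yM; apply/andP; split.
  rewrite subUset sub1set (subset_trans (subsetDl _ _) Wsub) andbT.
  by apply/bigcupP; exists i.
apply/forallP => k; have [->|ki] := eqVneq k i.
  suff -> : (y |: W :\ x) :&: ground (M i) = y |: (W :&: ground (M i)) :\ x by [].
  by apply/setP => z; rewrite !inE; case: eqVneq => [->|_] /=; rewrite ?yi ?andbA.
suff -> : (y |: W :\ x) :&: ground (M k) = W :&: ground (M k) by [].
apply/setP => z; rewrite !inE; have [zk|] := boolP (z \in ground (M k)); rewrite ?andbF //.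
rewrite !andbT; have -> : z == y = false.
  by apply: contraNF ki => /eqP zy; rewrite (disjoint_groundsP zk (j := i)) // zy.
suff -> : z == x = false by [].
by apply: contraNF ki => /eqP zy; rewrite (disjoint_groundsP zk (j := i)) // zy.
Qed.

Lemma sum_bases_extend i j Bi Bj :
  i != j -> Bi \in bases (M i) -> Bj \in bases (M j) ->
  exists W, [/\ W \in sum_bases M, W :&: ground (M i) = Bi & W :&: ground (M j) = Bj].
Proof.
move=> ij BiM BjM; pose f k := if k == i then Bi else if k == j then Bj
  else xchoose (bases_neq0 (M k)).
have fM k : f k \in bases (M k).
  rewrite /f; case: eqP => [->//|_]; case: eqP => [->//|_].
  exact: (xchooseP (bases_neq0 (M k))).
have fE k : (\bigcup_l f l) :&: ground (M k) = f k.
  apply/setP => z; rewrite inE; apply/andP/idP => [[/bigcupP[l _ zl] zk]|zk].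
    by rewrite -(disjoint_groundsP (subsetP (basis_sub (fM l)) z zl) zk).
  by split; [apply/bigcupP; exists k | apply: (subsetP (basis_sub (fM k)))].
exists (\bigcup_l f l); rewrite !fE /f eqxx eq_sym (negPf ij) eqxx; split=> //.
rewrite mem_sum_bases; apply/andP; split; last by apply/forallP => k; rewrite fE.
apply/bigcupsP => k _; exact: subset_trans (basis_sub (fM k)) (bigcup_sup k _).
Qed.

End DirectSums.

(** * Crossing chords and crossing exchanges *)

Definition between n (a c v : 'I_n) : bool := (a < v < c) || (c < v < a).

Lemma cyclically_ordered_between n (a b c d : 'I_n) :
  cyclically_ordered a b c d -> between a c b != between a c d.
Proof. by rewrite /cyclically_ordered /between; lia. Qed.

(** Crossing is a symmetric relation between chords with distinct endpoints. *)
Lemma between_swap n (a c x y : 'I_n) :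
  x != a -> x != c -> y != a -> y != c ->
  between a c x != between a c y -> between x y a != between x y c.
Proof.
have neqE (p q : 'I_n) : (p != q) = (p != q :> nat) by [].
by rewrite !neqE /between; lia.
Qed.

Lemma betweenE (R : realFieldType) n (x x' y' : 'I_n) :
  between x' y' x = ((x'%:R - x%:R) * (y'%:R - x%:R) < 0 :> R)%R.
Proof.
rewrite mulr_lt0 /between !subr_eq0 !subr_lt0 !eqr_nat !ltr_nat.
by case: (ltngtP x x') => a; case: (ltngtP x y') => b //=; lia.
Qed.

(** Both exchanges act on one common basis [W]. With [K] equal to [W] without [x] and [x'], the four
    mixed pairs extend [K] to bases while [x], [y] do not, so [nonneg_rep_not_crossing] applies. *)
Lemma crossing_exchanges (R : realFieldType) n (I : finType) (N : I -> matroid 'I_n)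
    d (A : 'M[R]_(d, n)) i j Bi Bj (x y x' y' : 'I_n) :
  disjoint_grounds N -> nonneg_rep A (sum_bases N) -> i != j ->
  Bi \in bases (N i) -> x \in Bi -> y \notin Bi -> y |: (Bi :\ x) \in bases (N i) ->
  Bj \in bases (N j) -> x' \in Bj -> y' \notin Bj ->
  y' |: (Bj :\ x') \in bases (N j) ->
  between x' y' x = between x' y' y.
Proof.
move=> dis rA ij BiM xBi yBi BiM' BjM x'Bj y'Bj BjM'.
have [W [WM Wi Wj]] := sum_bases_extend dis ij BiM BjM.
have xi : x \in ground (N i) := subsetP (basis_sub BiM) _ xBi.
have yi : y \in ground (N i) := subsetP (basis_sub BiM') _ (setU11 _ _).
have x'j : x' \in ground (N j) := subsetP (basis_sub BjM) _ x'Bj.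
have y'j : y' \in ground (N j) := subsetP (basis_sub BjM') _ (setU11 _ _).
have ne p q : p \in ground (N i) -> q \in ground (N j) -> p != q.
  by move=> pi qj; apply: contraNneq ij => pq; rewrite (disjoint_groundsP dis pi (j := j)) // pq.
have [xx' xy' yx' yy'] := And4 (ne _ _ xi x'j) (ne _ _ xi y'j) (ne _ _ yi x'j) (ne _ _ yi y'j).
have xW : x \in W by move: xBi; rewrite -Wi inE => /andP[].
have x'W : x' \in W by move: x'Bj; rewrite -Wj inE => /andP[].
have yW : y \notin W by move: yBi; rewrite -Wi inE yi andbT.
have y'W : y' \notin W by move: y'Bj; rewrite -Wj inE y'j andbT.
have xy : x != y by apply: contraNneq yW => <-.
pose K := W :\ x :\ x'.
have W1 : y |: (W :\ x) \in sum_bases N.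
  by apply: sum_bases_exchange WM xi yi _; rewrite ?Wi.
have W2 : y' |: (W :\ x') \in sum_bases N.
  by apply: sum_bases_exchange WM x'j y'j _; rewrite ?Wj.
(* The exchange in component [i] leaves the trace on component [j] equal to [Bj], so the second
   exchange is still available. *)
have W3 : y' |: ((y |: (W :\ x)) :\ x') \in sum_bases N.
  apply: sum_bases_exchange W1 x'j y'j _ => //.
  suff -> : (y |: W :\ x) :&: ground (N j) = Bj by [].
  rewrite -Wj; apply/setP => z; rewrite !inE.
  have [zj|] := boolP (z \in ground (N j)); rewrite ?andbF // !andbT.
  by rewrite ![z == _]eq_sym !(negPf (ne _ _ _ zj)).
have K1 : x |: (x' |: K) = W.
  apply/setP => z; rewrite !inE; have [->|] := eqVneq z x; first by rewrite xW.
  by have [->|] := eqVneq z x'; rewrite ?x'W.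
have K2 : x |: (y' |: K) = y' |: (W :\ x').
  apply/setP => z; rewrite !inE; have [->|] := eqVneq z x.
    by rewrite xW xx' orbT.
  by [].
have K3 : y |: (x' |: K) = y |: (W :\ x).
  apply/setP => z; rewrite !inE; have [->|] := eqVneq z x'; last by [].
  by rewrite x'W [x' == x]eq_sym xx' orbT.
have K4 : y |: (y' |: K) = y' |: ((y |: (W :\ x)) :\ x').
  apply/setP => z; rewrite !inE; have [->|] := eqVneq z y; last by [].
  by rewrite yx' orbT.
(* Its trace on component [i] would be a basis containing [Bi] and also [y], against
   [basis_antichain]. *)
have Bxy : x |: (y |: K) \notin sum_bases N.
  apply/negP; rewrite mem_sum_bases // => /andP[_ /forallP/(_ i) Q].
  have yQ : y \in (x |: (y |: K)) :&: ground (N i) by rewrite !inE yi eqxx orbT.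
  suff E : Bi = (x |: (y |: K)) :&: ground (N i) by rewrite -E (negPf yBi) in yQ.
  apply: (basis_antichain BiM Q); rewrite -Wi; apply/subsetP => z.
  rewrite !inE => /andP[zW zi]; rewrite zi (ne _ _ zi x'j) zW /= andbT.
  by case: eqVneq => //=; rewrite orbT.
have xK : x \notin K by rewrite !inE eqxx !andbF.
have x'K : x' \notin K by rewrite !inE eqxx.
have yK : y \notin K by rewrite !inE (negPf yW) !andbF.
have y'K : y' \notin K by rewrite !inE (negPf y'W) !andbF.
have := nonneg_rep_not_crossing rA xK yK x'K y'K xx' xy' yx' yy' xy.
rewrite K1 K2 K3 K4 => /(_ WM W2 W1 W3 Bxy).
rewrite !(betweenE R) -mulrA.
have nz p q : p != q -> (q%:R - p%:R != 0 :> R)%R.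
  by move=> pq; rewrite subr_eq0 eqr_nat eq_sym.
(* [P] and [Q] have the same sign, which decides whether [x] and [y] lie between [x'] and [y']. *)
set P := (X in (0 < X * _)%R); set Q := (X in (0 < _ * X)%R) => PQ.
have P0 : (P != 0)%R by rewrite mulf_neq0 ?nz.
case: (ltgtP P 0%R) P0 => // P0 _.
  by move: PQ; rewrite nmulr_rgt0 // => ->.
by move: PQ; rewrite pmulr_rgt0 // => Q0; rewrite ltNge ltW.
Qed.

(** Connectedness is used twice: a crossing of two components first yields an exchange in one that
    crosses the chord [a c], then an exchange in the other that crosses the first exchange. *)
Lemma positroid_components_noncrossing (R : realType) n (M : matroid 'I_n) t
    (N : 'I_t -> matroid 'I_n) :
  positroid_on R [set: 'I_n] M -> connected_components M N ->
  noncrossing_partition [set ground (N i) | i : 'I_t].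
Proof.
move=> Mpos [Nne Ncon [dis ME]].
have gM : ground M = [set: 'I_n] by case: Mpos.
have [d [A [rA _]]] := positroid_nonneg_rep Mpos.
rewrite ME /= in rA gM; split.
  apply/and3P; split.
  - apply/eqP; rewrite -gM /cover /sum_ground.
    apply/setP => z; apply/bigcupP/bigcupP => [[_ /imsetP[i _ ->] zi]|[i _ zi]].
      by exists i.
    by exists (ground (N i)) => //; apply: imset_f.
  - apply/trivIsetP => _ _ /imsetP[i _ ->] /imsetP[j _ ->] ij.
    move/forallP: (dis) => /(_ i)/forallP/(_ j)/implyP; apply.
    by apply: contraNneq ij => ->.
  - by apply/imsetP => -[i _ /esym/eqP]; rewrite (negPf (Nne i)).
move=> _ _ /imsetP[i _ ->] /imsetP[j _ ->] SS' [a [b [c [d' [cyc ai ci bj dj]]]]].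
have ij : i != j by apply: contraNneq SS' => ->.
have ne p q : p \in ground (N i) -> q \in ground (N j) -> q != p.
  by move=> pi qj; apply: contraNneq ij => pq; rewrite (disjoint_groundsP dis pi (j := j)) // -pq.
(* A version of [connected_cut] that does not fix which of [u], [v] lies in [X]. *)
have sep (T : finType) (M' : matroid T) (X : {set T}) u v : connected M' ->
    u \in ground M' -> v \in ground M' -> (u \in X) != (v \in X) ->
    exists B x y, [/\ B \in bases M', x \in B, y \notin B,
      y |: (B :\ x) \in bases M' & (x \in X) != (y \in X)].
  move=> con ug vg; case: (boolP (u \in X)) => [uX /= vX|uX].
    exact: (connected_cut con ug vg).
  by case: (boolP (v \in X)) => // vX _; apply: (connected_cut con vg ug).
have [|Bj [x' [y' [BjM x'Bj y'Bj BjM' xy'cut]]]] :=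
  sep _ _ [set v | between a c v] b d' (Ncon j) bj dj.
  by rewrite !inE cyclically_ordered_between.
have x'j : x' \in ground (N j) := subsetP (basis_sub BjM) _ x'Bj.
have y'j : y' \in ground (N j) := subsetP (basis_sub BjM') _ (setU11 _ _).
(* Now [x'] and [y'] lie on different sides of [a c], so by [between_swap] the chord [x' y']
   separates [a] from [c]. *)
have [|Bi [x [y [BiM xBi yBi BiM' xycut]]]] :=
  sep _ _ [set v | between x' y' v] a c (Ncon i) ai ci.
  by rewrite !inE in xy'cut *; apply: between_swap xy'cut; apply: ne.
rewrite !inE (crossing_exchanges dis rA ij BiM xBi yBi BiM' BjM x'Bj y'Bj BjM') in xycut.
by rewrite eqxx in xycut.
Qed.

Local Open Scope ring_scope.

(** * Non-crossing direct sums *)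

Definition ord_cat (T : Type) d1 d2 (f1 : 'I_d1 -> T) (f2 : 'I_d2 -> T)
    (i : 'I_(d1 + d2)) : T :=
  match split i with inl j => f1 j | inr j => f2 j end.

Section OrdCat.
Variables (T : finType) (d1 d2 : nat).
Implicit Types (f : 'I_d1 -> T) (g : 'I_d2 -> T).

Lemma ord_catl f g i : ord_cat f g (lshift d2 i) = f i.
Proof. by rewrite /ord_cat (unsplitK (inl i)). Qed.

Lemma ord_catr f g i : ord_cat f g (rshift d1 i) = g i.
Proof. by rewrite /ord_cat (unsplitK (inr i)). Qed.

Lemma ord_cat_image f g :
  ord_cat f g @: [set: 'I_(d1 + d2)] =
  (f @: [set: 'I_d1]) :|: (g @: [set: 'I_d2]).
Proof.
apply/setP => z; apply/imsetP/setUP.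
  by case=> i _ ->; rewrite /ord_cat; case: split => j; [left|right]; apply: imset_f.
by case=> /imsetP[i _ ->]; [exists (lshift d2 i) | exists (rshift d1 i)];
  rewrite ?ord_catl ?ord_catr.
Qed.

Lemma ord_cat_shift (h : 'I_(d1 + d2) -> T) :
  h =1 ord_cat (h \o @lshift d1 d2) (h \o @rshift d1 d2).
Proof.
by move=> i; rewrite -[i]splitK; case: split => j; rewrite /= ?ord_catl ?ord_catr.
Qed.

End OrdCat.

(** * Gluing two nonnegative representations *)

Section Gluing.
Variable R : realFieldType.

(** Pairs of positions lie within the first part, within the second, or across; the cross pairs give
    the double product. *)
Lemma vdm_cat n d1 d2 (f1 : 'I_d1 -> 'I_n) (f2 : 'I_d2 -> 'I_n) :
  vdm R (ord_cat f1 f2) =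
  vdm R f1 * vdm R f2 * \prod_i \prod_j ((f2 j)%:R - (f1 i)%:R).
Proof.
rewrite !vdmE big_split_ord /= mulrAC -big_split /=; congr (_ * _).
  apply: eq_bigr => i _; rewrite big_mkcond big_split_ord /= [in RHS]big_mkcond.
  congr (_ * _); apply: eq_bigr => j _; rewrite !(ord_catl, ord_catr) //=.
  by rewrite (leq_trans (ltn_ord i)) ?leq_addr.
apply: eq_bigr => i _; rewrite big_mkcond big_split_ord /= [in RHS]big_mkcond.
rewrite [X in X * _]big1 ?mul1r => [|j _]; last first.
  by rewrite ltnNge ltnW // (leq_trans (ltn_ord j)) ?leq_addr.
by apply: eq_bigr => j _; rewrite !ord_catr ltn_add2l.
Qed.

(** Some term of the Leibniz expansion is nonzero. *)
Lemma det_neq0_transversal d (X : 'M[R]_d) :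
  \det X != 0 -> exists s : 'S_d, forall i, X i (s i) != 0.
Proof.
have [/existsP[s /forallP sX] _|nos] :=
  boolP [exists s : 'S_d, [forall i, X i (s i) != 0]]; first by exists s.
rewrite /determinant big1 ?eqxx // => s _; move/existsPn/(_ s): nos.
rewrite negb_forall => /existsP[i]; rewrite negbK => /eqP Xi.
by rewrite (bigD1 i) //= Xi mul0r mulr0.
Qed.

Lemma det_colsub_col_mx n d1 d2 (A : 'M[R]_(d1, n)) (C : 'M[R]_(d2, n))
    (U S : {set 'I_n}) (f1 : 'I_d1 -> 'I_n) (f2 : 'I_d2 -> 'I_n) :
  [disjoint U & S] ->
  (forall i j, j \notin U -> A i j = 0) -> (forall i j, j \notin S -> C i j = 0) ->
  (forall i, f1 i \in U) -> (forall i, f2 i \in S) ->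
  \det (colsub (ord_cat f1 f2) (col_mx A C)) =
  \det (colsub f1 A) * \det (colsub f2 C).
Proof.
move=> dUS A0 C0 f1U f2S.
rewrite -(det_ublock _ 0); congr (\det _).
apply/matrixP => i j; rewrite mxE -[i]splitK -[j]splitK.
case: (split i) (split j) => i' [] j' /=.
- by rewrite block_mxEul col_mxEu ord_catl mxE.
- rewrite block_mxEur col_mxEu ord_catr mxE A0 //.
  by apply: contraL (f2S j') => fU; rewrite (disjointFr dUS).
- by rewrite block_mxEdl col_mxEd ord_catl mxE C0 // (disjointFr dUS).
- by rewrite block_mxEdr col_mxEd ord_catr mxE.
Qed.

(** With columns from [U] listed first, minor and [vdm] both factor, except for the cross
    differences in [vdm]. By the order hypothesis their sign is a product of signs attached to
    elements of [U], which scaling the columns of [A] absorbs. *)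
Lemma nonneg_rep_glue n d1 d2 (A : 'M[R]_(d1, n)) (C : 'M[R]_(d2, n)) Bs1 Bs2
    (U S : {set 'I_n}) :
  nonneg_rep A Bs1 -> nonneg_rep C Bs2 ->
  (forall i j, j \notin U -> A i j = 0) -> (forall i j, j \notin S -> C i j = 0) ->
  [disjoint U & S] ->
  (forall u v v', u \in U -> v \in S -> v' \in S -> (u < v)%N = (u < v')%N) ->
  exists A' : 'M[R]_(d1 + d2, n),
    nonneg_rep A' [set B1 :|: B2 | B1 in Bs1, B2 in Bs2] /\
    forall i j, j \notin U :|: S -> A' i j = 0.
Proof.
move=> rA rC A0 C0 dUS gap.
(* The sign of \prod_(v in B) (v - u) for u in U, the same for all bases B of the
   second matroid: #|B| = d2 and all of S lies on one side of u. *)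
pose s (u : 'I_n) : R := (-1) ^+ (if [exists v in S, v < u]%N then d2 else 0).
have s_gap u (f2 : 'I_d2 -> 'I_n) : u \in U -> (forall i, f2 i \in S) ->
    0 <= s u * \prod_j ((f2 j)%:R - u%:R).
  move=> uU f2S; rewrite /s; case: exists_inP => [[v vS vu]|noex].
    rewrite -[d2 in _ ^+ d2]card_ord -prodr_const -big_split /=.
    apply: prodr_ge0 => j _; rewrite mulN1r opprB subr_ge0 ler_nat leqNgt.
    by rewrite (gap u _ v) // -leqNgt ltnW.
  rewrite expr0 mul1r; apply: prodr_ge0 => j _; rewrite subr_ge0 ler_nat leqNgt.
  by apply/negP => lt; apply: noex; exists (f2 j).
pose A1 : 'M[R]_(d1, n) := \matrix_(i, j) (A i j * s j).
have A10 i j : j \notin U -> A1 i j = 0 by move=> jU; rewrite mxE A0 ?mul0r.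
have DA1 f : \det (colsub f A1) = \det (colsub f A) * \prod_j s (f j).
  rewrite -[\prod_j _](_ : \det (diag_mx (\row_j s (f j))) = _); last first.
    by rewrite det_diag; apply: eq_bigr => j _; rewrite mxE.
  rewrite -det_mulmx; congr (\det _); apply/matrixP => i j.
  by rewrite mul_mx_diag !mxE.
have prods_neq0 f : \prod_(j < d1) s (f j) != 0.
  by apply/prodf_neq0 => j _; rewrite signr_eq0.
pose A' := col_mx A1 C.
have split_f (f : 'I_(d1 + d2) -> 'I_n) : \det (colsub f A') != 0 ->
    exists (t : 'S_(d1 + d2)) f1 f2, [/\ f \o t =1 ord_cat f1 f2,
      forall i, f1 i \in U & forall i, f2 i \in S].
  (* The nonzero entries chosen in the first [d1] rows lie in columns of [U], those in the last [d2]
     rows in columns of [S], so [t] sorts the columns by block. *)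
  move=> /det_neq0_transversal[t tf]; exists t.
  exists (f \o t \o @lshift d1 d2), (f \o t \o @rshift d1 d2); split.
  - exact: ord_cat_shift.
  - move=> i; move: (tf (lshift d2 i)); rewrite mxE col_mxEu.
    by apply: contraR => /A10->.
  - move=> i; move: (tf (rshift d1 i)); rewrite mxE col_mxEd.
    by apply: contraR => /C0->.
have Dcat := det_colsub_col_mx dUS A10 C0.
exists A'; split; last first.
  move=> i j; rewrite inE negb_or => /andP[jU jS].
  by rewrite mxE; case: split => k; rewrite ?A10 ?C0.
split=> [f|B].
  have [->|Df] := eqVneq (\det (colsub f A')) 0; first by rewrite mul0r.
  have [t [f1 [f2 [ft f1U f2S]]]] := split_f f Df.
  rewrite -(det_vdm_perm _ _ t) (eq_det_colsub _ ft) (eq_vdm R ft).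
  rewrite Dcat // vdm_cat DA1.
  have -> : forall a b c x y z : R, a * b * c * (x * y * z) = (a * x) * (c * y) * (b * z).
    by move=> *; ring.
  apply: mulr_ge0; first exact: mulr_ge0 (proj1 rA f1) (proj1 rC f2).
  rewrite -big_split.
  by apply: prodr_ge0 => i _; apply: s_gap.
split=> [/imset2P[B1 B2 /(proj2 rA)[f1 Df1 f1B] /(proj2 rC)[f2 Df2 f2B] ->]|].
  exists (ord_cat f1 f2); last by rewrite ord_cat_image f1B f2B.
  rewrite Dcat ?DA1 ?mulf_neq0 //.
    exact: det_colsub_support A0 Df1.
  exact: det_colsub_support C0 Df2.
case=> f Df fB; have [t [f1 [f2 [ft f1U f2S]]]] := split_f f Df.
have : \det (colsub (f \o t) A') != 0 by rewrite det_colsub_perm mulf_neq0 ?signr_eq0.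
rewrite (eq_det_colsub _ ft) Dcat // DA1 !mulf_eq0 !negb_or => /andP[/andP[Df1 _] Df2].
apply/imset2P; exists (f1 @: [set: 'I_d1]) (f2 @: [set: 'I_d2]).
- by apply/(proj2 rA); exists f1.
- by apply/(proj2 rC); exists f2.
have tT : t @: [set: 'I_(d1 + d2)] = [set: 'I_(d1 + d2)].
  apply/setP => z; rewrite inE; apply/imsetP.
  by exists (t^-1%g z); rewrite ?permKV.
by rewrite -ord_cat_image -(eq_imset _ ft) imset_comp tT fB.
Qed.

End Gluing.

Local Close Scope ring_scope.

(** * Direct sums over a subset of the summands *)

Section PartialSums.
Variables (T I : finType) (M : I -> matroid T).
Hypothesis dis : disjoint_grounds M.

(** Described by traces, as in [mem_sum_bases], so that an induction over [J] keeps the index type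
    fixed. *)
Definition partial_sum_bases (J : {set I}) : {set {set T}} :=
  [set B : {set T} | (B \subset \bigcup_(i in J) ground (M i)) &&
                     [forall i in J, B :&: ground (M i) \in bases (M i)]].

Lemma partial_sum_bases0 : partial_sum_bases set0 = [set set0].
Proof.
apply/setP => B; rewrite !inE big_set0 subset0; case: eqP => //= _.
by apply/forall_inP => i; rewrite inE.
Qed.

Lemma partial_sum_basesT : partial_sum_bases [set: I] = sum_bases M.
Proof.
apply/setP => B; rewrite inE mem_sum_bases // /sum_ground.
rewrite (eq_bigl xpredT) => [|i]; last by rewrite inE.
congr (_ && _).
by apply: eq_forallb => i; rewrite inE implyTb.
Qed.

Lemma partial_sum_basesD1 (J : {set I}) i : i \in J ->
  partial_sum_bases J =
  [set B1 :|: B2 | B1 in partial_sum_bases (J :\ i), B2 in bases (M i)].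
Proof.
move=> iJ; set U := \bigcup_(j in J :\ i) ground (M j).
have UE : \bigcup_(j in J) ground (M j) = ground (M i) :|: U.
  by rewrite (big_setD1 i).
have Ui z : z \in U -> z \notin ground (M i).
  case/bigcupP => j; rewrite !inE => /andP[ji _] zj; apply: contra ji => zi.
  by apply/eqP/(disjoint_groundsP dis zj zi).
apply/setP => B; apply/idP/imset2P; last first.
  case=> B1 B2; rewrite inE => /andP[B1U /forall_inP B1M] B2M ->.
  rewrite inE UE setUC setUSS ?basis_sub //=; apply/forall_inP => j jJ.
  have [->|ji] := eqVneq j i.
    suff -> : (B2 :|: B1) :&: ground (M i) = B2 by [].
    apply/setP => z; rewrite !inE; have [zB2|zB2] := boolP (z \in B2).
      by rewrite (subsetP (basis_sub B2M)).
    by apply/negP => /andP[/(subsetP B1U)/Ui/negPf->].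
  suff -> : (B2 :|: B1) :&: ground (M j) = B1 :&: ground (M j).
    by apply: B1M; rewrite !inE ji.
  apply/setP => z; rewrite !inE; case: (boolP (z \in B2)) => //= zB2.
  have zi := subsetP (basis_sub B2M) z zB2.
  have -> : z \in ground (M j) = false; last by rewrite andbF.
  by apply: contraNF ji => zj; apply/eqP/(disjoint_groundsP dis zj zi).
rewrite inE UE => /andP[/subsetP BU /forall_inP BM].
exists (B :&: U) (B :&: ground (M i)); last 1 first.
- by apply/setP => z; move: (BU z); rewrite !inE orbC;
    case: (z \in B) => //= /(_ isT)->.
- rewrite inE subsetIr; apply/forall_inP => j; rewrite !inE => /andP[ji jJ].
  suff -> : B :&: U :&: ground (M j) = B :&: ground (M j) by apply: BM.
  rewrite -setIA; congr (_ :&: _); apply/setIidPr/(bigcup_sup j).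
  by rewrite !inE ji.
- exact: BM.
Qed.

End PartialSums.

(** * Induction over the blocks of a non-crossing partition *)

Lemma nonneg_rep_set0 (R : realFieldType) n :
  nonneg_rep (0 : 'M[R]_(0, n)) [set set0].
Proof.
split=> [f|B]; first by rewrite /vdm !det_mx00 mulr1 ler01.
have im0 (f : 'I_0 -> 'I_n) : f @: [set: 'I_0] = set0.
  by apply/setP => z; rewrite inE; apply/imsetP => -[[]].
rewrite inE; split=> [/eqP->|[f _ <-]]; last by rewrite im0.
have f0 : 'I_0 -> 'I_n by case.
by exists f0; rewrite ?im0 // det_mx00 oner_neq0.
Qed.

Lemma noncrossing_sum_positroid (R : realType) n t (S : 'I_t -> {set 'I_n})
    (M : 'I_t -> matroid 'I_n) :
  injective S -> noncrossing_partition [set S i | i : 'I_t] ->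
  (forall i, positroid_on R (S i) (M i)) ->
  exists dis : disjoint_grounds M, positroid_on R [set: 'I_n] (direct_sum dis).
Proof.
move=> SI [/and3P[/eqP covS triv S0] nc] pos.
have gM i : ground (M i) = S i by case: (pos i).
have dis : disjoint_grounds M.
  apply/forallP => i; apply/forallP => j; apply/implyP => ij; rewrite !gM.
  by apply: (trivIsetP triv); rewrite ?imset_f // (inj_eq SI).
exists dis.
have /fin_all_exists[mn mnP] i :
    exists m, m \in S i /\ forall v, v \in S i -> m <= v.
  have /set0Pn[x xS] : S i != set0.
    by apply: contraNneq S0 => <-; apply: imset_f.
  by exists [arg min_(m < x in S i) m]; case: arg_minnP.
(* If [v < u < v'], then [mn i < v] because [mn i <= mn j <= v] and the blocks are disjoint, so
   [mn i], [v], [u], [v'] is a crossing. *)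
have gap i j u v v' : i != j -> mn i <= mn j -> u \in S i -> v \in S j ->
    v' \in S j -> u < v' -> u < v.
  move=> ij mij uS vS v'S uv'; rewrite ltnNge; apply/negP => vu.
  have ne p q : p \in S i -> q \in S j -> p != q :> nat.
    move=> pS qS; apply: contraNneq ij => /val_inj pq.
    by apply/eqP/(disjoint_groundsP dis (x := p)); rewrite gM // pq.
  apply: (nc (S i) (S j)); rewrite ?imset_f ?(inj_eq SI) //.
  have [mS _] := mnP i; have [_ /(_ v vS) mjv] := mnP j.
  exists (mn i), v, u, v'; split=> //.
  have := ne _ _ uS vS; have := ne _ _ mS vS.
  by rewrite /cyclically_ordered; lia.
suff partial (J : {set 'I_t}) : exists d (A : 'M[R]_(d, n)),
    nonneg_rep A (partial_sum_bases M J) /\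
    forall i j, j \notin \bigcup_(k in J) ground (M k) -> A i j = 0%R.
  have [d [A [rA _]]] := partial [set: 'I_t].
  apply: (nonneg_rep_positroid (A := A)); last by rewrite /= -partial_sum_basesT.
  apply/setP => z; rewrite inE; move/setP/(_ z): covS; rewrite inE.
  case/bigcupP => _ /imsetP[i _ ->] zS.
  by apply/bigcupP; exists i; rewrite ?gM.
move: {2}#|J| (erefl #|J|) => k; elim: k => [|k IH] in J *.
  move/eqP; rewrite cards_eq0 => /eqP->; exists 0, 0%R.
  by rewrite partial_sum_bases0; split=> [|[]] //; apply: nonneg_rep_set0.
move=> cJ; have /set0Pn[j0 j0J] : J != set0 by rewrite -cards_eq0 cJ.
(* The block with the largest minimum is glued on last, so [gap] applies to it against every other
   block of [J]. *)
case: (@arg_maxnP _ j0 (mem J) mn j0J) => i iJ imax; have {}iJ : i \in J := iJ.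
have [|d1 [A [rA A0]]] := IH (J :\ i).
  by move: cJ; rewrite (cardsD1 i) iJ add1n => -[].
have [d2 [C [rC C0]]] := positroid_nonneg_rep (pos i).
have [||A' [rA' A'0]] := nonneg_rep_glue rA rC A0 C0.
- rewrite disjoint_sym; apply/bigcup_disjointP => j; rewrite !inE => /andP[ji _].
  by rewrite -gM; move/forallP: (dis) => /(_ i)/forallP/(_ j)/implyP; apply; rewrite eq_sym.
- move=> u v v' /bigcupP[j]; rewrite !inE gM => /andP[ji jJ] uS vS v'S.
  by apply/idP/idP; apply: (gap j i) => //; apply: imax.
exists (d1 + d2), A'; rewrite (partial_sum_basesD1 dis iJ); split=> // l m.
by rewrite (big_setD1 i) //= gM setUC => /A'0.
Qed.

Theorem theorem7p6 (R : realType) (n : nat) :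
  (forall M : matroid 'I_n,
     positroid_on R [set: 'I_n] M ->
     forall (t : nat) (N : 'I_t -> matroid 'I_n),
       connected_components M N ->
       noncrossing_partition [set ground (N i) | i : 'I_t])
  /\
  (forall (t : nat) (S : 'I_t -> {set 'I_n}) (M : 'I_t -> matroid 'I_n),
     injective S ->
     noncrossing_partition [set S i | i : 'I_t] ->
     (forall i, connected (M i)) ->
     (forall i, positroid_on R (S i) (M i)) ->
     exists dis : disjoint_grounds M,
       positroid_on R [set: 'I_n] (direct_sum dis)).
Proof.
split=> [M Mpos t N|t S M SI nc _ pos].
  exact: (positroid_components_noncrossing Mpos).
exact: noncrossing_sum_positroid nc pos.
Qed.
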